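(* Let $S$ be a band of topological groups and $N$ be a full normal subcryptogroup of $S$. Then the following conditions are equivalent: (i) $S/N$ is Hausdorff; (ii) $\rho_N$ is closed in $S\times S$; (iii) $N$ is closed in $S$.
   Context: A topological semigroup is a semigroup $S$ with a topology such that $(x,y)\mapsto xy$, $S\times S\to S$, is continuous. $E(S)$ is the set of idempotents of $S$. A semigroup $S$ is completely regular if for each $a\in S$ there is $x\in S$ with $a=axa$ and $ax=xa$. In such a semigroup Green's relations are: $a\,\mathcal{L}\,b$ iff $Sa=Sb$; $a\,\mathcal{R}\,b$ iff $aS=bS$; $\mathcal{H}=\mathcal{L}\cap\mathcal{R}$. A cryptogroup is a completely regular semigroup in which $\mathcal{H}$ is a congruence. In a cryptogroup, each $\mathcal{H}$-class $H_x$ is a group, $x^0$ is its identity, and $x^{-1}$ is the inverse of $x$ in the group $H_x$. A band is a semigroup in which every element is idempotent; a band congruence on $S$ is a congruence $\rho$ with $S/\rho$ a band. A topological semigroup $(S,\tau)$ is a band $B$ of topological groups $(G_\alpha,\tau_\alpha)$ $(\alpha\in B)$ if $S$ admits a band congruence $\rho$ such that $S/\rho=B$, each $G_\alpha$ is a topological group (under the operation of $S$ and the topology $\tau_\alpha$) that is the $\rho$-class mapped onto $\alpha$ by the natural epimorphism $S\to B$, and $\bigcup_{\alpha\in B}\tau_\alpha$ is a base for $\tau$. ''Band of topological groups'' means a band $B$ of topological groups for some $B$ and some $(G_\alpha,\tau_\alpha)$; every such $S$ is a cryptogroup. A full normal subcryptogroup of a cryptogroup $S$ is a nonempty subset $N$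 with $E(S)\subseteq N$; $xy,x^{-1}\in N$ for all $x,y\in N$; and $sks^{-1}\in N$ for all $s\in S$, $k\in N$. The relation $\rho_N$ on $S$ is defined by $a\,\rho_N\,b$ iff $a^{-1}b\in N$ and $a^0=b^0$; it is a congruence on $S$. $S/N$ denotes $S/\rho_N$ with the quotient topology: $U\subseteq S/N$ is open iff $\psi^{-1}(U)$ is open in $S$, where $\psi:S\to S/N$ is the natural epimorphism. *)

(* Defs.v *)
From HB Require Import structures.
From mathcomp Require Import all_boot generic_quotient.
From mathcomp Require Import all_classical topology.

Set Implicit Arguments.
Unset Strict Implicit.
Unset Printing Implicit Defensive.

Local Open Scope classical_set_scope.
Local Open Scope quotient_scope.
Local Open Scope group_scope.

HB.mixin Record isTopologicalSemigroup S of Topological S & Semigroup S := {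
  mulg_continuous : continuous (fun p : S * S => p.1 * p.2) }.

#[short(type="topologicalSemigroupType")]
HB.structure Definition TopologicalSemigroup :=
  {S of isTopologicalSemigroup S & Topological S & Semigroup S}.

HB.mixin Record hasContinuousInv G of Topological G & Group G := {
  invg_continuous : continuous (fun x : G => x^-1) }.

(* No separation axiom is imposed. *)
#[short(type="topologicalGroupType")]
HB.structure Definition TopologicalGroup :=
  {G of hasContinuousInv G & TopologicalSemigroup G & Group G}.

Definition is_congruence (S : semigroupType) (r : S -> S -> Prop) :=
  [/\ forall x, r x x,
      forall x y, r x y -> r y x,
      forall x y z, r x y -> r y z -> r x z &
      forall x x' y y', r x x' -> r y y' -> r (x * y) (x' * y')].

Record congruence (S : semigroupType) := Congruence {
  crel :> S -> S -> Prop;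
  crelP : is_congruence crel }.

Section Quotient.
Variables (S : semigroupType) (r : congruence S).

Definition crelb : rel S := fun x y => `[< r x y >].

Lemma crelb_refl : reflexive crelb.
Proof. by case: (crelP r) => h _ _ _ x; apply/asboolP. Qed.

Lemma crelb_sym : symmetric crelb.
Proof.
case: (crelP r) => _ h _ _ x y.
by apply/asboolP/asboolP; exact: h.
Qed.

Lemma crelb_trans : transitive crelb.
Proof.
case: (crelP r) => _ _ h _ y x z /asboolP xy /asboolP yz.
by apply/asboolP; exact: h xy yz.
Qed.

Canonical crelb_equiv := EquivRel crelb crelb_refl crelb_sym crelb_trans.

(* The quotient semigroup S / r; \pi_(quot r) is the natural epimorphism. *)
Definition quot : Type := {eq_quot crelb}.

HB.instance Definition _ := EqQuotient.on quot.
HB.instance Definition _ := Choice.on quot.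

Lemma pi_eqP (x y : S) : \pi_quot x = \pi_quot y <-> r x y.
Proof. by split=> [/eqmodP/asboolP|h]; [|apply/eqmodP/asboolP]. Qed.

Definition quot_mul (a b : quot) : quot := \pi_quot (repr a * repr b).

Lemma pi_mul (x y : S) : \pi_quot (x * y) = quot_mul (\pi_quot x) (\pi_quot y).
Proof.
case: (crelP r) => _ sym _ compat.
by apply/pi_eqP; apply: compat; apply/pi_eqP; rewrite reprK.
Qed.

Lemma quot_mulA : associative quot_mul.
Proof.
move=> a b c; rewrite -[a]reprK -[b]reprK -[c]reprK.
move: (repr a) (repr b) (repr c) => x y z.
by rewrite -(pi_mul y z) -(pi_mul x) -(pi_mul x y) -(pi_mul _ z) mulgA.
Qed.

HB.instance Definition _ := isSemigroup.Build quot quot_mulA.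

Lemma pi_mulg (x y : S) :
  \pi_quot (x * y) = \pi_quot x * \pi_quot y :> quot.
Proof. exact: pi_mul. Qed.

End Quotient.

Definition idempotents (S : semigroupType) : set S := [set x | x * x = x].

Definition is_band (B : semigroupType) := forall x : B, x * x = x.

Definition completely_regular (S : semigroupType) :=
  forall a : S, exists x, a = a * x * a /\ a * x = x * a.

Section Green.
Variable S : semigroupType.
Implicit Types a b x y e : S.

Definition greenL a b := range (fun s => s * a) = range (fun s => s * b).
Definition greenR a b := range (fun s => a * s) = range (fun s => b * s).
Definition greenH a b := greenL a b /\ greenR a b.

Definition is_Hunit x e :=
  greenH x e /\ forall y, greenH x y -> e * y = y /\ y * e = y.

(* x^0, the identity of the group H_x; the junk value x is taken when H_x has
   no identity, which does not happen in a completely regular semigroup. *)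
Definition Hunit x : S := xget x [set e | is_Hunit x e].

(* x^-1, the inverse of x in the group H_x, with the same convention. *)
Definition Hinv x : S :=
  xget x [set y | [/\ greenH x y, x * y = Hunit x & y * x = Hunit x]].

End Green.

Definition cryptogroup (S : semigroupType) :=
  completely_regular S /\ is_congruence (@greenH S).

Record full_normal_subcryptogroup (S : semigroupType) (N : set S) : Prop := {
  fns_nonempty : N !=set0;
  fns_full : @idempotents S `<=` N;
  fns_mul : forall x y, N x -> N y -> N (x * y);
  fns_inv : forall x, N x -> N (Hinv x);
  fns_normal : forall s k, N k -> N (s * k * Hinv s) }.

Definition rho (S : semigroupType) (N : set S) (a b : S) :=
  N (Hinv a * b) /\ Hunit a = Hunit b.

(* The topological group G_alpha, external to S, is identified by the injective
   morphism i alpha with the r-class that \pi maps onto alpha; its open sets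
   thus become the sets i alpha @` U. *)
Definition band_of_topological_groups (S : topologicalSemigroupType) :=
  exists (r : congruence S) (G : quot r -> topologicalGroupType)
         (i : forall alpha, G alpha -> S),
  [/\ is_band (quot r),
      forall alpha, injective (i alpha),
      forall alpha g h, i alpha (g * h) = i alpha g * i alpha h,
      forall alpha, range (i alpha) = [set x | \pi_(quot r) x = alpha] &
      basis (\bigcup_alpha [set i alpha @` U | U in [set U | open U]])].

Section CompletelyRegular.
Variables (S : semigroupType) (crS : completely_regular S).
Implicit Types a b x y e : S.

Lemma greenH_refl x : greenH x x. Proof. by []. Qed.

Lemma greenH_sym x y : greenH x y -> greenH y x.
Proof. by case=> l r; split; symmetry. Qed.

Lemma greenH_trans x y z : greenH x y -> greenH y z -> greenH x z.
Proof. by case=> l r [l' r']; split; [rewrite /greenL l|rewrite /greenR r]. Qed.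

Lemma greenLI a b (s t : S) : a = s * b -> b = t * a -> greenL a b.
Proof.
move=> ab ba; apply/seteqP; split=> _ [u _ <-] /=.
  by exists (u * s) => //; rewrite ab mulgA.
by exists (u * t) => //; rewrite ba mulgA.
Qed.

Lemma greenRI a b (s t : S) : a = b * s -> b = a * t -> greenR a b.
Proof.
move=> ab ba; apply/seteqP; split=> _ [u _ <-] /=.
  by exists (s * u) => //; rewrite ab mulgA.
by exists (t * u) => //; rewrite ba mulgA.
Qed.

Lemma greenHE a b : greenH a b ->
  (exists s, a = s * b) /\ (exists s, a = b * s).
Proof.
have [x [ax _]] := crS a; case=> l r; split.
  have : range (fun s => s * a) a by exists (a * x).
  by rewrite l => -[s _ <-]; exists s.
have : range (fun s => a * s) a by exists (x * a) => //; rewrite mulgA.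
by rewrite r => -[s _ <-]; exists s.
Qed.

Lemma HunitP x : is_Hunit x (Hunit x).
Proof.
apply: (@xgetPex _ x [set e | is_Hunit x e]); have [y [xyx xy]] := crS x.
exists (x * y); split.
  split; [apply: (@greenLI _ _ x y) | apply: (@greenRI _ _ x y)] => //.
  by rewrite xy mulgA.
move=> z /greenH_sym/greenHE[[s ->] [t e]]; split.
  by rewrite e mulgA -xyx.
by rewrite xy -mulgA (mulgA x) -xyx.
Qed.

Lemma Hunit_uniq x e : is_Hunit x e -> e = Hunit x.
Proof.
case=> He uxe; have [Hu uxu] := HunitP x.
by rewrite -[LHS](uxu _ He).1 (uxe _ Hu).2.
Qed.

Lemma HinvP x :
  [/\ greenH x (Hinv x), x * Hinv x = Hunit x & Hinv x * x = Hunit x].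
Proof.
apply: (@xgetPex _ x
  [set y | [/\ greenH x y, x * y = Hunit x & y * x = Hunit x]]).
have [y [xyx xy]] := crS x.
have <- : x * y = Hunit x.
  apply: Hunit_uniq; split.
    split; [apply: (@greenLI _ _ x y) | apply: (@greenRI _ _ x y)] => //.
    by rewrite xy mulgA.
  move=> z /greenH_sym/greenHE[[s ->] [t e]]; split.
    by rewrite e mulgA -xyx.
  by rewrite xy -mulgA (mulgA x) -xyx.
have e1 : x * (y * x * y) = x * y by rewrite !mulgA -xyx.
have e2 : y * x * y * x = x * y by rewrite -2!mulgA (mulgA x) -xyx -xy.
exists (y * x * y); split=> //; split.
- apply: (@greenLI _ _ (x * x) (y * y)).
    by rewrite -[RHS]mulgA e1 xy mulgA.
  by rewrite -!mulgA xy.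
- apply: (@greenRI _ _ (x * x) (y * y)).
    by rewrite [RHS]mulgA e2.
  by rewrite mulgA xy.
Qed.

Lemma Hunit_eq a b : greenH a b -> Hunit a = Hunit b.
Proof.
move=> Hab; have [Ha ua] := HunitP a; apply: Hunit_uniq; split.
  exact: greenH_trans (greenH_sym Hab) Ha.
by move=> y Hby; apply: ua; exact: greenH_trans Hab Hby.
Qed.

Lemma greenH_unit x : greenH x (Hunit x). Proof. by case: (HunitP x). Qed.

Lemma eq_Hunit a b : Hunit a = Hunit b -> greenH a b.
Proof.
move=> ab; apply: greenH_trans (greenH_unit a) _.
by rewrite ab; exact/greenH_sym/greenH_unit.
Qed.

Lemma mulHu a b : greenH a b -> Hunit a * b = b.
Proof. by case: (HunitP a) => _ h /h[]. Qed.

Lemma mulHur a b : greenH a b -> b * Hunit a = b.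
Proof. by case: (HunitP a) => _ h /h[]. Qed.

Lemma Hunit_idem x : @idempotents S (Hunit x).
Proof. exact/mulHu/greenH_unit. Qed.

Lemma greenH_inv x : greenH x (Hinv x). Proof. by case: (HinvP x). Qed.
Lemma mulxHV x : x * Hinv x = Hunit x. Proof. by case: (HinvP x). Qed.
Lemma mulHVx x : Hinv x * x = Hunit x. Proof. by case: (HinvP x). Qed.

Lemma greenH_mul a b : greenH a b -> greenH a (a * b).
Proof.
move=> Hab; have aE : a = a * b * Hinv b.
  by rewrite -mulgA mulxHV -(Hunit_eq Hab) mulHur.
have bE : b = Hinv a * (a * b) by rewrite mulgA mulHVx mulHu.
split; last exact: greenRI aE erefl.
exact: (etrans Hab.1 (greenLI bE erefl)).
Qed.

Lemma Hinv_uniq x y : greenH x y -> x * y = Hunit x -> y = Hinv x.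
Proof.
move=> Hxy xy; rewrite -[LHS](mulHu Hxy) -mulHVx -mulgA xy.
exact/mulHur/greenH_inv.
Qed.

End CompletelyRegular.

Section Rho.
Variables (S : semigroupType) (cS : cryptogroup S).
Variables (N : set S) (fN : full_normal_subcryptogroup N).
Let crS := cS.1.

Let N_unit x : N (Hunit x).
Proof. exact: (fns_full fN (Hunit_idem crS x)). Qed.

Let rho_trans (x y z : S) : rho N x y -> rho N y z -> rho N x z.
Proof.
case=> Nxy xy [Nyz yz]; split; last by rewrite xy.
have := fns_mul fN Nxy Nyz; rewrite mulgA -(mulgA _ y) mulxHV// -xy.
by rewrite (mulHur crS (greenH_inv crS x)).
Qed.

Let rho_quot (x y : S) : Hunit x = Hunit y -> y = x * (Hinv x * y).
Proof.
by move=> xy; rewrite mulgA mulxHV// mulHu//; exact: eq_Hunit.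
Qed.

Lemma rho_is_congruence : is_congruence (rho N).
Proof.
have [_ _ _ compat] := cS.2.
split.
- by move=> x; split=> //; rewrite mulHVx.
- move=> x y [Nxy xy]; split=> //; have Hxy := eq_Hunit crS xy.
  have Hxv := greenH_inv crS x; have Hyv := greenH_inv crS y.
  have H1 : greenH x (Hinv x * y).
    apply: (greenH_trans Hxv); apply: greenH_mul => //.
    exact: greenH_trans (greenH_sym Hxv) Hxy.
  have H2 : greenH y (Hinv y * x).
    apply: (greenH_trans Hyv); apply: greenH_mul => //.
    exact: greenH_trans (greenH_sym Hyv) (greenH_sym Hxy).
  suff -> : Hinv y * x = Hinv (Hinv x * y) by exact: fns_inv.
  apply: Hinv_uniq => //.
    exact: greenH_trans (greenH_sym H1) (greenH_trans Hxy H2).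
  rewrite mulgA -(mulgA _ y) mulxHV// -xy (mulHur crS Hxv) mulHVx//.
  exact: Hunit_eq.
- exact: rho_trans.
- move=> x x' y y' [Nx ux] [Ny uy].
  have Hx := eq_Hunit crS ux; have Hy := eq_Hunit crS uy.
  apply: (@rho_trans _ (x' * y)); split.
  + set g := x * y; set n := Hinv x * x' in Nx.
    have x'E : x' = x * n by exact: rho_quot.
    pose s := Hinv g * x.
    have Hn : greenH (Hunit x) n.
      apply: greenH_trans (greenH_sym (greenH_unit crS x)) _.
      apply: greenH_trans (greenH_inv crS x) _; apply: greenH_mul => //.
      exact: greenH_trans (greenH_sym (greenH_inv crS x)) Hx.
    have Hsn : greenH s (s * n).
      have {1}-> : s = s * Hunit x.
        by rewrite -mulgA (mulHur crS (greenH_refl x)).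
      exact: compat.
    have -> : Hinv g * (x' * y) = s * n * Hinv s * (s * y).
      rewrite [RHS]mulgA -(mulgA (s * n)) mulHVx// (mulHur crS Hsn) x'E.
      by rewrite !mulgA.
    apply: (fns_mul fN); first exact: fns_normal.
    by rewrite -mulgA mulHVx.
  + by apply: Hunit_eq => //; exact: compat.
  + rewrite (rho_quot uy) (mulgA x') mulgA mulHVx//.
    by apply: fns_mul.
  + by apply: Hunit_eq => //; exact: compat.
Qed.

Definition rho_congruence := Congruence rho_is_congruence.

End Rho.

Lemma band_of_topological_groups_cryptogroup (S : topologicalSemigroupType) :
  band_of_topological_groups S -> cryptogroup S.
Proof.
case=> r [G [i [bandB inj iM ran _]]].
have class x y : r x y -> exists al (g h : G al), i al g = x /\ i al h = y.
  move=> /pi_eqP xy; exists (\pi_(quot r) x).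
  have : range (i (\pi_(quot r) x)) x by rewrite ran.
  have : range (i (\pi_(quot r) x)) y by rewrite ran /= -xy.
  by case=> h _ hy [g _ gx]; exists g, h.
have [rxx _ _ _] := crelP r.
have crS : completely_regular S.
  move=> x; have [al [g [_ [<- _]]]] := class _ _ (rxx x).
  by exists (i al g^-1); rewrite -!iM mulgV mulVg mul1g.
split=> //.
have rH x y : r x y <-> greenH x y.
  split.
    move=> /class[al [g [h [<- <-]]]]; split.
      by apply: (@greenLI _ _ _ (i _ (g * h^-1)) (i _ (h * g^-1)));
        rewrite -iM -mulgA mulVg mulg1.
    by apply: (@greenRI _ _ _ (i _ (h^-1 * g)) (i _ (g^-1 * h)));
      rewrite -iM mulgA mulgV mul1g.
  move=> Hxy; apply/pi_eqP.
  have [[s xs] _] := greenHE crS Hxy.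
  have [_ [t yt]] := greenHE crS (greenH_sym Hxy).
  have e1 : \pi_(quot r) x * \pi_(quot r) y = \pi_(quot r) x.
    by rewrite {1 2}xs pi_mulg -mulgA bandB.
  have e2 : \pi_(quot r) x * \pi_(quot r) y = \pi_(quot r) y.
    by rewrite {1 2}yt pi_mulg mulgA bandB.
  by rewrite -e1.
have [h1 h2 h3 h4] := crelP r; split=> [x|x y|x y z|x x' y y'].
- by apply/rH.
- by move=> /rH h; apply/rH/h2.
- by move=> /rH xy /rH yz; apply/rH; exact: h3 xy yz.
- by move=> /rH xx /rH yy; apply/rH; exact: h4.
Qed.

(* S / N, with its semigroup structure forgotten. *)
Definition quotient_by (S : topologicalSemigroupType)
    (hS : band_of_topological_groups S) (N : set S)
    (hN : full_normal_subcryptogroup N) : topologicalType :=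
  quotient_topology
    (quot (rho_congruence (band_of_topological_groups_cryptogroup hS) hN)).

(* Main.v *)
Require Import Defs.
From mathcomp Require Import all_boot.
From mathcomp Require Import all_classical topology.

(** Each class of the band congruence of a band of topological groups is an open
    H-class, and its topology is the one of the corresponding topological
    group.  Two analytic facts follow: x |-> x^0 is locally constant
    ([Hunit_locally_constant]), and x |-> x^-1 is continuous
    ([Hinv_continuous]).  The rest of the argument holds in any topological
    cryptogroup with these two properties, and it is the usual one for
    topological groups, carried out inside one H-class at a time.

    Since rho_N is {(a, b) | a^0 = b^0 and a^-1 b \in N}, it is closed when N
    is, by continuity of (a, b) |-> a^-1 b and because the condition a^0 = b^0
    defines a clopen set ([closed_rho]).  Conversely N is the preimage of
    rho_N under the continuous map x |-> (x^0, x) ([rho_closed_sub]).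

    For the quotient, rho_N is the preimage of the diagonal under psi x psi, so
    it is closed when S / N is Hausdorff.  The converse holds because psi is an
    open map ([pi_open]): an open box around (a, b) that avoids rho_N is sent
    to a pair of disjoint open sets. *)

Section TopologicalCryptogroup.
Local Open Scope classical_set_scope.
Local Open Scope quotient_scope.
Local Open Scope group_scope.

Lemma greenH_idem_Hunit (S : semigroupType) (crS : completely_regular S)
  (x e : S) : greenH x e -> e * e = e -> e = Hunit x.
Proof.
move=> xe ee; rewrite (Hunit_eq crS xe).
by rewrite -[LHS](mulHu crS (greenH_refl e)) -(mulHVx crS e) -mulgA ee.
Qed.

Lemma Hunit_Hunit (S : semigroupType) (crS : completely_regular S) (x : S) :
  Hunit (Hunit x) = Hunit x.
Proof. exact/esym/(Hunit_eq crS)/(greenH_unit crS). Qed.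

Lemma Hinv_Hunit (S : semigroupType) (crS : completely_regular S) (x : S) :
  Hinv (Hunit x) = Hunit x.
Proof.
apply/esym/(Hinv_uniq crS) => //.
by rewrite Hunit_Hunit//; exact: Hunit_idem.
Qed.

Section Closedness.
Variables (S : topologicalSemigroupType) (cS : cryptogroup S).
Hypothesis Hunit_near : forall x : S, \forall y \near x, Hunit y = Hunit x.
Let crS := cS.1.
Variables (N : set S) (fN : full_normal_subcryptogroup N).

Local Notation Q := (quotient_topology (quot (rho_congruence cS fN))).

(** N is the union of the rho_N-classes of the idempotents. *)
Lemma rho_HunitE (x : S) : rho N (Hunit x) x <-> N x.
Proof.
rewrite /rho Hunit_Hunit// Hinv_Hunit// (mulHu crS (greenH_refl x)).
by split=> [[]|].
Qed.

Lemma rho_closed_sub : closed [set p : S * S | rho N p.1 p.2] -> closed N.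
Proof.
move=> clR.
have -> : N = (fun x => (Hunit x, x)) @^-1` [set p : S * S | rho N p.1 p.2].
  by apply/seteqP; split=> x /=; rewrite rho_HunitE.
apply: preimage_closed => // x _; apply: cvg_pair => //.
exact: near_cst_continuous (Hunit_near x).
Qed.

Lemma closed_rho : continuous (@Hinv S) ->
  closed N -> closed [set p : S * S | rho N p.1 p.2].
Proof.
move=> Vcont clN; apply: closedI.
  apply: (@preimage_closed _ _ (fun p : S * S => Hinv p.1 * p.2)) => // -[a b] _.
  apply: (@continuous_comp _ _ _ (fun p : S * S => (Hinv p.1, p.2))
    (fun p : S * S => p.1 * p.2)); last exact: mulg_continuous.
  apply: cvg_pair; last exact: cvg_snd.
  by apply: continuous_comp; [exact: cvg_fst|exact: Vcont].
rewrite -openC openE => -[a b] /= ab.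
exists ([set x | Hunit x = Hunit a], [set y | Hunit y = Hunit b]).
  by split; exact: Hunit_near.
by move=> [x y] [/= -> ->].
Qed.

(** If y is in the saturation of an open U, say x rho_N y with x \in U, then
    right translation by m := y^-1 x sends y to x, hence a neighbourhood of y
    into U; and it moves each point of H_y inside its rho_N-class, as m is in
    N. *)
Lemma pi_open (U : set S) : open U -> open (\pi_Q @` U).
Proof.
move=> oU; have [_ sym _ _] := rho_is_congruence cS fN.
rewrite /open /= /quotient_open openE => y /= [x Ux /pi_eqP xy].
have [Nm uyx] := sym _ _ xy; set m := Hinv y * x in Nm.
have Hyx := eq_Hunit crS uyx; have Hyv := greenH_inv crS y.
have Hym : greenH y m.
  apply: (greenH_trans Hyv); apply: greenH_mul => //.
  exact: greenH_trans (greenH_sym Hyv) Hyx.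
have ym : y * m = x by rewrite mulgA mulxHV// mulHu.
have mcont : {for y, continuous (fun z => z * m)}.
  apply: (@continuous_comp _ _ _ (fun z : S => (z, m))
    (fun p : S * S => p.1 * p.2)); last exact: mulg_continuous.
  by apply: cvg_pair => //; exact: cvg_cst.
have nU : \forall z \near y, U (z * m).
  by apply: mcont; rewrite ym; exact: open_nbhs_nbhs.
apply: filterS (filterI nU (Hunit_near y)) => z [Uzm uzy].
have Hzm : greenH z m := greenH_trans (eq_Hunit crS uzy) Hym.
exists (z * m) => //; apply/pi_eqP; apply: sym; split.
  by rewrite mulgA mulHVx// mulHu.
exact/(Hunit_eq crS)/(greenH_mul crS).
Qed.

Lemma hausdorff_closed_rho :
  hausdorff_space Q <-> closed [set p : S * S | rho N p.1 p.2].
Proof.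
split=> [|clR].
  rewrite open_hausdorff => sepQ; rewrite -openC openE => -[a b] /= nab.
  have : (\pi_Q a : Q) != \pi_Q b.
    by apply/eqP => /pi_eqP.
  move=> /sepQ[[A B] /= [/set_mem Aa /set_mem Bb] [oA oB /eqP AB0]].
  exists (\pi_Q @^-1` A, \pi_Q @^-1` B).
    by split; apply: open_nbhs_nbhs.
  move=> [x y] [/= Ax By] xy.
  suff : (A `&` B) (\pi_Q x) by rewrite AB0.
  by split=> //; rewrite (_ : \pi_Q x = \pi_Q y)//; apply/pi_eqP.
rewrite open_hausdorff => p q; rewrite -[p]reprK -[q]reprK.
move: (repr p) (repr q) => a b /eqP ab.
have /= : nbhs (a, b) (~` [set p : S * S | rho N p.1 p.2]).
  apply: open_nbhs_nbhs; split; first by rewrite openC.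
  by move=> /= Rab; apply: ab; apply/pi_eqP.
move=> [[A B] /= [nA nB] AB].
exists (\pi_Q @` A°, \pi_Q @` B°) => /=.
  by split; apply/mem_set; [exists a|exists b].
split; [exact/pi_open/open_interior|exact/pi_open/open_interior|].
apply/eqP; rewrite -subset0 => _ [[x Ax <-] [y By /pi_eqP yx]].
have [_ sym _ _] := rho_is_congruence cS fN.
apply: (AB (x, y)); last exact: sym.
by split; exact: interior_subset.
Qed.

End Closedness.

Section BandOfTopologicalGroups.
Variables (S : topologicalSemigroupType).

Lemma band_class_greenH (r : congruence S) (G : quot r -> topologicalGroupType)
    (i : forall alpha, G alpha -> S) :
  (forall alpha g h, i alpha (g * h) = i alpha g * i alpha h) ->
  forall alpha g h, greenH (i alpha g) (i alpha h).
Proof.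
move=> iM al g h; split.
  by apply: (@greenLI _ _ _ (i _ (g * h^-1)) (i _ (h * g^-1)));
    rewrite -iM -mulgA mulVg mulg1.
by apply: (@greenRI _ _ _ (i _ (h^-1 * g)) (i _ (g^-1 * h)));
  rewrite -iM mulgA mulgV mul1g.
Qed.

(** A basic open neighbourhood lies in a single class, hence in a single
    H-class. *)
Lemma Hunit_locally_constant : band_of_topological_groups S ->
  forall x : S, \forall y \near x, Hunit y = Hunit x.
Proof.
move=> hS; have [crS _] := band_of_topological_groups_cryptogroup hS.
case: hS => r [G [i [_ _ iM _ [oB nB]]]] x.
have [U [BU Ux] _] := nB x _ filterT.
have nU : nbhs x U by apply: open_nbhs_nbhs; split => //; exact: oB.
apply: filterS nU => y; case: BU Ux => al _ [V _ <-] [g _ <-] [h _ <-].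
exact/(Hunit_eq crS)/band_class_greenH.
Qed.

(** A basic neighbourhood of x^-1 lies in the class of x, and its image under
    inversion in the topological group on that class is again basic. *)
Lemma Hinv_continuous : band_of_topological_groups S -> continuous (@Hinv S).
Proof.
move=> hS; have [crS _] := band_of_topological_groups_cryptogroup hS.
case: hS => r [G [i [_ inj iM ran [oB nB]]]].
have iV al g : Hinv (i al g) = i al g^-1.
  have iH := @band_class_greenH r G i iM al.
  apply/esym/Hinv_uniq => //; rewrite -iM mulgV.
  by apply: greenH_idem_Hunit => //; rewrite -iM mul1g.
have pi_i al g : \pi_(quot r) (i al g) = al.
  by have : range (i al) (i al g) by []; rewrite ran.
move=> x W nW.
have : range (i (\pi_(quot r) x)) x by rewrite ran.
case=> g _; move: (\pi_(quot r) x) g => al g xg.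
have [U [[be _ [V oV VU]] Ux] UW] := nB _ _ nW.
move: Ux; rewrite -{1}VU -xg iV => -[v Vv vg].
have ab : be = al by rewrite -(pi_i al g^-1) -vg pi_i.
subst be; move: vg => /inj vg; rewrite vg in Vv.
have oV' : open [set h : G al | V h^-1].
  by apply: open_comp => // h _; exact: invg_continuous.
have nU' : nbhs x (i al @` [set h | V h^-1]).
  apply: open_nbhs_nbhs; split; last by exists g.
  by apply: oB; exists al => //; exists [set h | V h^-1].
rewrite -xg in nU' *; apply: filterS nU' => _ [h Vh <-]; rewrite /= iV.
by apply: UW; rewrite /= -VU; exists h^-1.
Qed.

End BandOfTopologicalGroups.

End TopologicalCryptogroup.

Theorem theorem6p8 (S : topologicalSemigroupType)
  (hS : band_of_topological_groups S)
  (N : set S) (hN : full_normal_subcryptogroup N) :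
  (hausdorff_space (quotient_by hS hN) <->
     closed [set p : S * S | rho N p.1 p.2]%classic) /\
  (closed [set p : S * S | rho N p.1 p.2]%classic <-> closed N).
Proof.
have unear := @Hunit_locally_constant S hS.
have cS := band_of_topological_groups_cryptogroup hS.
split; first exact: hausdorff_closed_rho.
split; first exact: rho_closed_sub.
by apply: closed_rho => //; exact: Hinv_continuous.
Qed.
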